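(* For all integers $s\ge 3$ and $m\ge 1$, the graph $K_{1,s}\times P_{2m+2}$ is antimagic.
   Context: $K_{1,s}$ denotes the star with one center and $s$ leaves, and $P_n$ denotes the path on $n$ vertices. For graphs $G$ and $H$, the direct product $G\times H$ has vertex set $V(G)\times V(H)$, with $(x,y)$ adjacent to $(x',y')$ if and only if $xx'\in E(G)$ and $yy'\in E(H)$. A (possibly disconnected) graph $G$ is antimagic if there is a bijection $f:E(G)\to\{1,2,\dots,|E(G)|\}$ such that the vertex sums $\sum_{e\ni v} f(e)$ are pairwise distinct over all vertices $v$ of $G$. *)

(* Defs.v *)
From mathcomp Require Import all_boot.

Set Implicit Arguments.
Unset Strict Implicit.
Unset Printing Implicit Defensive.

Record sgraph := SGraph {
  vertex :> finType;
  adj : rel vertex;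
  adj_sym : symmetric adj;
  adj_irrefl : irreflexive adj
}.

Definition edges (G : sgraph) : {set {set G}} :=
  [set [set p.1; p.2] | p : G * G & adj p.1 p.2].

Definition vertex_sum (G : sgraph) (f : {set G} -> nat) (v : G) : nat :=
  \sum_(e in edges G | v \in e) f e.

(* The labelling is a function on all vertex sets, constrained only on edges;
   its values elsewhere are irrelevant. *)
Definition edge_labelling (G : sgraph) (f : {set G} -> nat) : Prop :=
  [/\ forall e, e \in edges G -> 1 <= f e <= #|edges G|,
      {in edges G &, injective f}
    & forall k, 1 <= k <= #|edges G| -> exists2 e, e \in edges G & f e = k].

Definition antimagic (G : sgraph) : Prop :=
  exists2 f : {set G} -> nat, edge_labelling f & injective (vertex_sum f).

(* [None] is the center, the [Some i] are the leaves. *)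
Definition star_adj (s : nat) : rel (option 'I_s) :=
  fun x y => isSome x != isSome y.

Lemma star_adj_sym s : symmetric (@star_adj s).
Proof. by move=> x y; rewrite /star_adj eq_sym. Qed.

Lemma star_adj_irrefl s : irreflexive (@star_adj s).
Proof. by move=> x; rewrite /star_adj eqxx. Qed.

Definition star (s : nat) : sgraph :=
  SGraph (@star_adj_sym s) (@star_adj_irrefl s).

Definition path_adj (n : nat) : rel 'I_n :=
  fun x y => (x.+1 == y :> nat) || (y.+1 == x :> nat).

Lemma path_adj_sym n : symmetric (@path_adj n).
Proof. by move=> x y; rewrite /path_adj orbC. Qed.

Lemma path_adj_irrefl n : irreflexive (@path_adj n).
Proof. by move=> x; rewrite /path_adj orbb gtn_eqF. Qed.

Definition path_graph (n : nat) : sgraph :=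
  SGraph (@path_adj_sym n) (@path_adj_irrefl n).

Definition dprod_adj (G H : sgraph) : rel (G * H) :=
  fun p q => adj p.1 q.1 && adj p.2 q.2.

Lemma dprod_adj_sym G H : symmetric (@dprod_adj G H).
Proof. by move=> p q; rewrite /dprod_adj adj_sym [adj p.2 _]adj_sym. Qed.

Lemma dprod_adj_irrefl G H : irreflexive (@dprod_adj G H).
Proof. by move=> p; rewrite /dprod_adj adj_irrefl. Qed.

Definition direct_product (G H : sgraph) : sgraph :=
  SGraph (@dprod_adj_sym G H) (@dprod_adj_irrefl G H).

(* Main.v *)
Require Import Defs.
From mathcomp Require Import all_boot.
From mathcomp Require Import zify.

(** The product has two components, isomorphic by reversing the path.  Along
    each component, centers and layers of [s] leaves alternate, joined by
    blocks [k = 0, ..., 2m] of [s] edges; block [0] hangs at a center of degree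
    [s], and block [2m] consists of pendant edges.  The two components are
    interleaved: edge [i] of block [k] in component [b] is labelled
    [2i + b + 1 + 2s * r(k)], where [r] lists block [2m] first, then the odd
    blocks, then the even ones.  A leaf of degree two thus gets one small and
    one large label, which keeps all leaf sums distinct and at most [6sm + 4s].
    A center sum is [s * (2sm + x)], with [x = 3s + b] at the degree-[s]
    centers, [x = 2s + 2b] next to the pendant edges and
    [x = 4s(t + 1) + 2b] for [0 < t < m] elsewhere.  These are distinct, and
    exceed every leaf sum because [s >= 3]. *)

Set Implicit Arguments.
Unset Strict Implicit.
Unset Printing Implicit Defensive.

(** * Indexed labellings and auxiliary sums *)

Lemma antimagic_param (G : sgraph) (I : finType) (eps : I -> {set G})
    (h : I -> nat) :
  injective eps -> [set eps i | i : I] = edges G ->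
  injective h -> (forall i, 0 < h i <= #|I|) ->
  injective (fun v : G => \sum_(i | v \in eps i) h i) ->
  antimagic G.
Proof.
move=> eps_inj epsE h_inj h_bnd sum_inj.
have cardE : #|edges G| = #|I| by rewrite -epsE card_imset.
pose f (e : {set G}) := if [pick i | eps i == e] is Some i then h i else 0.
have fE i : f (eps i) = h i.
  rewrite /f; case: pickP => [j /eqP/eps_inj-> //|/(_ i)].
  by rewrite eqxx.
exists f.
  split=> [e|e e'|k].
  - by rewrite -{1}epsE => /imsetP[i _ ->]; rewrite fE cardE.
  - rewrite -epsE => /imsetP[i _ ->] /imsetP[j _ ->].
    by rewrite !fE => /h_inj->.
  rewrite cardE => k_bnd.
  (* Shifted down by one, [h] injects [I] into an ordinal type of the same size, hence is onto. *)
  have pred_lt i : (h i).-1 < #|I| by have := h_bnd i; lia.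
  pose r i := Ordinal (pred_lt i).
  have r_inj : injective r.
    move=> i j /(congr1 val) /= eq_h; apply: h_inj.
    by have := h_bnd i; have := h_bnd j; lia.
  have k_lt : k.-1 < #|I| by lia.
  have /codomP[i /(congr1 val) /= ki] :=
    inj_card_onto r_inj (eq_leq (card_ord _)) (Ordinal k_lt).
  exists (eps i); first by rewrite -epsE imset_f.
  by rewrite fE; have := h_bnd i; lia.
move=> u v; rewrite /vertex_sum -epsE.
have sumE w : \sum_(e in [set eps i | i : I] | w \in e) f e =
    \sum_(i | w \in eps i) h i.
  rewrite big_mkcondr big_imset; last by move=> i j _ _ /eps_inj.
  by rewrite [RHS]big_mkcond; apply: eq_bigr => i _; rewrite fE.
by rewrite !sumE => /sum_inj.
Qed.

Lemma sum_ord_succ n p (F : nat -> nat) :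
  \sum_(k < n | (k == p :> nat) || (k.+1 == p)) F k =
  (if p < n then F p else 0) + (if (0 < p) && (p <= n) then F p.-1 else 0).
Proof.
rewrite big_mkcond; elim: n => [|n IH]; first by rewrite big_ord0; case: p.
rewrite big_ord_recr /= {}IH.
have [<-|np] := eqVneq n p => /=; first by do !case: ifP => ?; lia.
have [<-|np'] := eqVneq n.+1 p => /=; by do !case: ifP => ?; lia.
Qed.

Lemma sum_linear n (b : bool) a r :
  \sum_(i < n) (a * (i.*2 + b).+1 + r) = n * (a * (n + b) + r).
Proof. by elim: n => [|n IH]; rewrite ?big_ord0 // big_ord_recr /= IH; nia. Qed.

(** * Coordinates on the product: component, position, column *)

Section StarPath.

Variables s m : nat.

Let G := direct_product (star s) (path_graph m.*2.+2).

(* The component of [v]; [pos v] is its position along it, where the component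
   of the centers at odd path positions is read backwards. *)
Definition side (v : G) : bool := odd v.2 (+) isSome v.1.

Definition pos (v : G) : nat := if side v then m.*2.+1 - v.2 else v.2.

(** At even [p] the column [i] is forgotten, so all columns share the centers. *)
Definition vtx (b : bool) (i : 'I_s) (p : nat) : G :=
  (if odd p then Some i else None, inord (if b then m.*2.+1 - p else p)).

Lemma pos_lt v : pos v < m.*2.+2.
Proof.
by rewrite /pos; case: v => x j /=; have := ltn_ord j; case: ifP; lia.
Qed.

(** Reversal flips parity because [2m+1] is odd, so centers have even position in both
    components. *)
Lemma odd_pos v : odd (pos v) = isSome v.1.
Proof.
rewrite /pos /side; case: v => x j /=; have := ltn_ord j.
by case: (isSome x); case: ifP; lia.
Qed.

Lemma side_vtx b i p : p < m.*2.+2 -> side (vtx b i p) = b.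
Proof.
move=> lt_p; rewrite /side /= inordK; last by case: b; lia.
by case: b; case: ifP => /=; lia.
Qed.

Lemma pos_vtx b i p : p < m.*2.+2 -> pos (vtx b i p) = p.
Proof.
move=> lt_p; rewrite /pos side_vtx //= inordK; last by case: b; lia.
by case: b; lia.
Qed.

Lemma vtxK v i : (v.1 == None) || (v.1 == Some i) -> vtx (side v) i (pos v) = v.
Proof.
move=> v1; rewrite /vtx odd_pos; have := erefl (pos v); rewrite {1}/pos.
case: v v1 => x j /= v1 pE; congr pair; first by case: x v1 {pE} => // i' /eqP.
apply: val_inj; rewrite /= inordK; move: pE; rewrite /pos /=;
  by have := ltn_ord j; case: ifP; lia.
Qed.

Lemma side_pos_inj u v :
  side u = side v -> pos u = pos v -> u.1 = v.1 -> u = v.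
Proof.
move=> cE pE; have := pE; rewrite /pos -cE.
case: u v {cE pE} => x j [y k] /= jk ->; congr pair; apply: val_inj => /=.
by have := ltn_ord j; have := ltn_ord k; move: jk; case: ifP; lia.
Qed.

(** A step of the product changes both the path parity and the kind of star vertex, so [side] is
    invariant. *)
Lemma adjE u v : adj u v =
  (side u == side v) && ((pos u == (pos v).+1) || (pos v == (pos u).+1)).
Proof.
have := odd_pos u; have := odd_pos v; have := pos_lt u; have := pos_lt v.
rewrite /= /dprod_adj /= /star_adj /path_adj /pos /side.
case: u v => x j [y k] /=; have := ltn_ord j; have := ltn_ord k.
case: (isSome x); case: (isSome y); do !case: ifP; lia.
Qed.

(** * Indexing of the edges *)

Definition edge_index := (bool * 'I_s * 'I_(m.*2.+1))%type.

Definition edge_of (e : edge_index) : {set G} :=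
  let: (b, i, k) := e in [set vtx b i k; vtx b i k.+1].

Lemma in_edge_of v b i k : (v \in edge_of (b, i, k)) =
  [&& b == side v, (v.1 == None) || (v.1 == Some i)
    & (k == pos v :> nat) || (k.+1 == pos v)].
Proof.
have lt_k := ltn_ord k.
have vtx1 p : ((vtx b i p).1 == None) || ((vtx b i p).1 == Some i).
  by rewrite /=; case: (odd p); rewrite ?eqxx ?orbT.
rewrite !inE; apply/orP/and3P => [[]/eqP->|[/eqP-> v1 /orP[]/eqP->]].
- by rewrite side_vtx ?pos_vtx ?eqxx ?vtx1 //; lia.
- by rewrite side_vtx ?pos_vtx ?eqxx ?vtx1 ?orbT //; lia.
- by left; rewrite vtxK.
- by right; rewrite vtxK.
Qed.

(** Both endpoints are tested: the one at an odd position is a leaf and reveals [i], and the two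
    positions together force [k]. *)
Lemma edge_of_inj : injective edge_of.
Proof.
move=> [[b i] k] [[b' i'] k'] eqE.
have lt_k := ltn_ord k; have lt_k' := ltn_ord k'.
have inE1 p : (p == k :> nat) || (p == k.+1) ->
    [&& b' == b, odd p ==> (i' == i) & (k' == p :> nat) || (k'.+1 == p)].
  move=> pk; have lt_p : p < m.*2.+2 by lia.
  have : vtx b i p \in edge_of (b', i', k').
    by rewrite -eqE !inE; case/orP: pk => /eqP->; rewrite eqxx ?orbT.
  rewrite in_edge_of side_vtx // pos_vtx // => /and3P[-> + ->].
  by rewrite /= andbT; case: (odd p) => //= /eqP[->].
have /and3P[/eqP-> i0 k0] := inE1 k ltac:(by rewrite eqxx).
have /and3P[_ i1 k1] := inE1 k.+1 ltac:(by rewrite eqxx orbT).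
have /eqP-> : i' == i by move: i0 i1; rewrite /=; case: (odd k).
by congr (_, _); apply: val_inj => /=; lia.
Qed.

Lemma edge_of_edges : [set edge_of e | e : edge_index] = edges G.
Proof.
apply/setP=> e; apply/imsetP/imsetP=> [[[[b i] k] _ ->]|[[u v] /=]].
  have lt_k := ltn_ord k.
  exists (vtx b i k, vtx b i k.+1) => //=.
  rewrite inE /= [dprod_adj _ _]adjE !side_vtx ?pos_vtx ?eqxx ?orbT //; lia.
rewrite inE /= => uv ->; move: uv; rewrite [dprod_adj _ _]adjE.
wlog vu : u v / pos v = (pos u).+1.
  move=> W; case/andP=> /eqP cE /orP[]/eqP pE.
    by rewrite setUC; apply: W => //; rewrite cE pE !eqxx orbT.
  by apply: W => //; rewrite cE pE !eqxx orbT.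
case/andP=> /eqP cE _.
(* Exactly one end is a leaf; it supplies the column [i]. *)
have [i ui vi] : exists2 i, (u.1 == None) || (u.1 == Some i)
    & (v.1 == None) || (v.1 == Some i).
  have := odd_pos v; rewrite vu /= odd_pos.
  case: u.1 => [i|]; case: v.1 => [j|] //= _; first by exists i => //=.
  by exists j => //=.
have lt_u : pos u < m.*2.+1 by have := pos_lt v; rewrite vu.
exists (side u, i, Ordinal lt_u) => //=.
by rewrite vtxK // cE -vu vtxK.
Qed.

(** * The labelling *)

Definition block_rank (k : nat) : nat :=
  if k == m.*2 then 0 else if odd k then k./2.+1 else (m + k./2).+1.

Lemma block_rank_lt k : k < m.*2.+1 -> block_rank k < m.*2.+1.
Proof. by rewrite /block_rank; case: ifP => //; case: ifP; lia. Qed.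

(** Block [2m] has rank 0, the odd blocks ranks [1] to [m], the other even blocks [m+1] to [2m]. *)
Lemma block_rank_inj k k' :
  k < m.*2.+1 -> k' < m.*2.+1 -> block_rank k = block_rank k' -> k = k'.
Proof.
by rewrite /block_rank; do !case: ifP => ?; lia.
Qed.

Definition label (b : bool) (i k : nat) : nat :=
  (i.*2 + b).+1 + s.*2 * block_rank k.

Definition index_label (e : edge_index) : nat :=
  let: (b, i, k) := e in label b i k.

Lemma index_label_inj : injective index_label.
Proof.
move=> [[b i] k] [[b' i'] k']; rewrite /= /label => eqL.
have lt_i := ltn_ord i; have lt_i' := ltn_ord i'.
(* These are the remainders of the labels minus one modulo [2s]; the ranks are the quotients. *)
have c_lt : i.*2 + b < s.*2 by lia.
have c_lt' : i'.*2 + b' < s.*2 by lia.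
have rE : block_rank k = block_rank k' by nia.
have cE : i.*2 + b = i'.*2 + b' by rewrite rE in eqL; lia.
have bE : b = b' by lia.
have iE : i = i' by apply: val_inj => /=; lia.
by rewrite bE iE; congr (_, _); apply: val_inj;
  exact: block_rank_inj (ltn_ord _) (ltn_ord _) rE.
Qed.

Lemma index_label_bound e : 0 < index_label e <= #|{: edge_index}|.
Proof.
rewrite !card_prod card_bool !card_ord; case: e => [[b i] k] /=.
have := block_rank_lt (ltn_ord k); have := ltn_ord i; rewrite /label; nia.
Qed.

(* A vertex sum only for odd [p]; for even [p] it is the contribution of column
   [i] to the sum at the center in position [p]. *)
Definition leaf_sum (b : bool) (p i : nat) : nat :=
  (if p < m.*2.+1 then label b i p else 0) +
  (if 0 < p then label b i p.-1 else 0).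

(** Incidence constrains component, column and block independently, so the sum splits; only the
    blocks [pos v] and [pos v - 1] survive. *)
Lemma sum_index v :
  \sum_(e | v \in edge_of e) index_label e =
  \sum_(i < s | (v.1 == None) || (v.1 == Some i)) leaf_sum (side v) (pos v) i.
Proof.
have le_p : pos v <= m.*2.+1 := pos_lt v.
rewrite (eq_bigl (fun e : edge_index => ((e.1.1 == side v) &&
    ((v.1 == None) || (v.1 == Some e.1.2))) &&
    ((e.2 == pos v :> nat) || (e.2.+1 == pos v)))); last first.
  by move=> [[b i] k]; rewrite in_edge_of /= andbA.
rewrite (eq_bigr (fun e : edge_index => label e.1.1 e.1.2 e.2)); last first.
  by move=> [[b i] k].
rewrite -(pair_big (fun c : bool * 'I_s => (c.1 == side v) &&
    ((v.1 == None) || (v.1 == Some c.2)))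
  (fun k : 'I_(m.*2.+1) => (k == pos v :> nat) || (k.+1 == pos v))
  (fun c k => label c.1 c.2 k)) /=.
rewrite (eq_bigr (fun c : bool * 'I_s => leaf_sum c.1 (pos v) c.2)); last first.
  by move=> c _; rewrite sum_ord_succ // ltnS andbC le_p.
rewrite -(pair_big (pred1 (side v))
  (fun i => (v.1 == None) || (v.1 == Some i))
  (fun b (i : 'I_s) => leaf_sum b (pos v) i)) /=.
by rewrite big_pred1_eq.
Qed.

(** * Closed forms of the vertex sums *)

Definition center_sum (b : bool) (p : nat) : nat :=
  \sum_(i < s) leaf_sum b p i.

(** The two blocks at the leaf have ranks [m+t+1] and [t+1]. *)
Lemma leaf_sum_odd b t i : t < m ->
  leaf_sum b t.*2.+1 i = (i.*2 + b).+1.*2 + s.*2 * (m + t.*2).+2.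
Proof.
move=> lt_t; rewrite /leaf_sum /label /block_rank /= odd_double.
rewrite uphalf_double doubleK; do !case: ifP => ?; lia.
Qed.

Lemma leaf_sum_last b i : leaf_sum b m.*2.+1 i = (i.*2 + b).+1.
Proof. by rewrite /leaf_sum ltnn /label /block_rank /= eqxx muln0 addn0. Qed.

Lemma center_sum_first b : 0 < m ->
  center_sum b 0 = s * (s + b + s.*2 * m.+1).
Proof.
move=> m_gt0; rewrite -[s + b]mul1n -sum_linear; apply: eq_bigr => i _.
rewrite /leaf_sum /label /block_rank /=; case: ifP => ?; lia.
Qed.

Lemma center_sum_mid b t : 0 < t < m ->
  center_sum b t.*2 = s * (2 * (s + b) + s.*2 * (m + t.*2).+1).
Proof.
move=> lt_t; rewrite -sum_linear; apply: eq_bigr => i _.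
rewrite /leaf_sum /label /block_rank /= odd_double doubleK.
do !case: ifP => ?; nia.
Qed.

Lemma center_sum_last b : 0 < m ->
  center_sum b m.*2 = s * (2 * (s + b) + s.*2 * m).
Proof.
move=> m_gt0; rewrite -sum_linear; apply: eq_bigr => i _.
rewrite /leaf_sum /label /block_rank /= eqxx.
do !case: ifP => ?; nia.
Qed.

(** * Distinctness of the vertex sums *)

Lemma leaf_sum_inj b b' p p' i i' : i < s -> i' < s ->
  odd p -> odd p' -> p < m.*2.+2 -> p' < m.*2.+2 ->
  leaf_sum b p i = leaf_sum b' p' i' -> [/\ b = b', p = p' & i = i'].
Proof.
move=> lt_i lt_i' odd_p odd_p'.
have -> : p = p./2.*2.+1 by lia.
have -> : p' = p'./2.*2.+1 by lia.
move: p./2 p'./2 => t t' {odd_p odd_p'} lt_t lt_t'.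
have [tm|tm] := ltnP t m; have [tm'|tm'] := ltnP t' m.
- rewrite !leaf_sum_odd // => eqS.
  have c_lt : i.*2 + b < s.*2 by lia.
  have c_lt' : i'.*2 + b' < s.*2 by lia.
  (* The offset [2(2i+b+1)] lies between [2] and [4s], while [t] contributes multiples of [4s]. *)
  have tE : t = t' by nia.
  rewrite tE in eqS *; split; lia.
- have -> : t' = m by lia.
  rewrite leaf_sum_last leaf_sum_odd //; nia.
- have -> : t = m by lia.
  rewrite leaf_sum_last leaf_sum_odd //; nia.
- have -> : t = m by lia.
  have -> : t' = m by lia.
  rewrite !leaf_sum_last; split; lia.
Qed.

(** The extreme case is [t = m-1], [i = s-1], [b = 1]. *)
Lemma leaf_sum_le b p i : i < s -> odd p -> p < m.*2.+2 ->
  leaf_sum b p i <= s.*2 * (3 * m + 2).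
Proof.
move=> lt_i odd_p; have -> : p = p./2.*2.+1 by lia.
move: p./2 => t lt_t; have [tm|tm] := ltnP t m.
  by rewrite leaf_sum_odd //; nia.
have -> : t = m by lia.
rewrite leaf_sum_last; nia.
Qed.

Definition center_excess (b : bool) (t : nat) : nat :=
  if t == 0 then 3 * s + b
  else if t == m then 2 * s + 2 * b else 4 * s * t.+1 + 2 * b.

Lemma center_sumE b t : 0 < m -> t <= m ->
  center_sum b t.*2 = s * (s.*2 * m + center_excess b t).
Proof.
move=> m_gt0 le_t; rewrite /center_excess; case: eqP => [->|t0].
  by rewrite center_sum_first //; congr (_ * _); nia.
case: eqP => [->|tm]; first by rewrite center_sum_last //; congr (_ * _); nia.
by rewrite center_sum_mid; [congr (_ * _); nia | lia].
Qed.

(** The excesses are ordered [2s < 2s+2 < 3s < 3s+1 < 8s], the second gap needing [s >= 3]; the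
    middle ones start at [8s] and come in pairs spaced by [4s]. *)
Lemma center_sum_inj b b' p p' : 2 < s -> 0 < m ->
  ~~ odd p -> ~~ odd p' -> p < m.*2.+2 -> p' < m.*2.+2 ->
  center_sum b p = center_sum b' p' -> b = b' /\ p = p'.
Proof.
move=> s_gt2 m_gt0 even_p even_p'.
have -> : p = p./2.*2 by lia.
have -> : p' = p'./2.*2 by lia.
move: p./2 p'./2 => t t' lt_t lt_t'.
rewrite !center_sumE; try lia.
move=> /eqP; rewrite eqn_pmul2l; last by lia.
rewrite eqn_add2l /center_excess => /eqP.
do !case: eqP => ?; subst; nia.
Qed.

(** With excess at least [2s] and [s >= 3], the sum is at least [6sm + 6s]. *)
Lemma center_sum_gt b p : 2 < s -> 0 < m -> ~~ odd p -> p < m.*2.+2 ->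
  s.*2 * (3 * m + 2) < center_sum b p.
Proof.
move=> s_gt2 m_gt0 even_p; have -> : p = p./2.*2 by lia.
move: p./2 => t lt_t; rewrite center_sumE //; last by lia.
have : 2 * s <= center_excess b t.
  by rewrite /center_excess; do !case: eqP => ?; nia.
move: (center_excess b t) => x le_x.
have : 3 * (s.*2 * m + x) <= s * (s.*2 * m + x) by rewrite leq_mul2r s_gt2 orbT.
nia.
Qed.

Lemma star_path_antimagic : 2 < s -> 0 < m -> antimagic G.
Proof.
move=> s_gt2 m_gt0.
apply: (antimagic_param edge_of_inj edge_of_edges index_label_inj).
  exact: index_label_bound.
have sum1 (j : 'I_s) (F : 'I_s -> nat) :
    \sum_(i < s | Some j == Some i) F i = F j.
  by rewrite (big_pred1 j) // => i; rewrite eq_sym.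
move=> u v; rewrite !sum_index.
have := odd_pos u; have := odd_pos v; have := pos_lt u; have := pos_lt v.
have := @side_pos_inj u v.
case: (u.1) => [i|]; case: (v.1) => [j|] /= eq_uv lt_v lt_u odd_v odd_u.
- rewrite !sum1 => /leaf_sum_inj[] // cE pE ijE; apply: eq_uv => //.
  by congr Some; apply: val_inj.
- rewrite sum1 => sE; have := leaf_sum_le (side u) (ltn_ord i) odd_u lt_u.
  rewrite sE leqNgt center_sum_gt //.
  by rewrite odd_v.
- rewrite sum1 => sE; have := leaf_sum_le (side v) (ltn_ord j) odd_v lt_v.
  rewrite -sE leqNgt center_sum_gt //.
  by rewrite odd_u.
move=> /center_sum_inj[] //; rewrite ?odd_u ?odd_v // => cE pE.
exact: eq_uv.
Qed.

End StarPath.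

Theorem theorem2p3 (s m : nat) (hs : 3 <= s) (hm : 1 <= m) :
  antimagic (direct_product (star s) (path_graph (2 * m + 2))).
Proof.
have -> : 2 * m + 2 = m.*2.+2 by lia.
exact: star_path_antimagic.
Qed.
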